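(* Let $a,b\in\mathbb{N}$ and let $n$ be a strong alpha number of order $(a,b)$ with $\omega(n)\le 2$. Then $n$ is not a perfect square.
   Context: For a positive integer $n$ and $x\in\mathbb{N}$, $\sigma_x(n)=\sum_{d\mid n} d^x$; $\omega(n)$ is the number of distinct prime divisors of $n$. A positive integer $n$ is a strong alpha number of order $(a,b)$ if there exist coprime positive integers $\alpha_1,\alpha_2$ with $\sigma_a(n)=\frac{\alpha_1}{\alpha_2}n^{b}$ and $2\le \max(\alpha_1,\alpha_2)\le \omega(n)$. *)

(* Defs.v *)
From mathcomp Require Import all_boot all_order all_algebra.
Import GRing.Theory.

Set Implicit Arguments.
Unset Strict Implicit.
Unset Printing Implicit Defensive.

Definition sigma (x n : nat) : nat := \sum_(d <- divisors n) d ^ x.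

Definition omega (n : nat) : nat := size (primes n).

Definition strong_alpha (a b n : nat) : Prop :=
  0 < n /\
  exists alpha1 alpha2 : nat,
    [/\ 0 < alpha1, 0 < alpha2, coprime alpha1 alpha2,
        ((sigma a n)%:R = (alpha1%:R / alpha2%:R) * n%:R ^+ b :> rat)%R
      & 2 <= maxn alpha1 alpha2 <= omega n].

Definition perfect_square (n : nat) : Prop := exists m : nat, n = m ^ 2.

(* Main.v *)
(** For a nonzero square [n] the divisor sum [sigma a n] is always odd: modulo 2
    it counts the divisors of [n] if [a = 0] and those of the odd part of [n] if
    [a > 0], and a nonzero square has an odd number of divisors because
    [d |-> n %/ d] is an involution whose only fixed point is the square root.
    As [omega n <= 2] forces the pair [(alpha1, alpha2)] to be [(2, 1)] or
    [(1, 2)], either [sigma a n] is twice [n ^ b] and hence even, or the square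
    [n ^ b] is twice the odd number [sigma a n], which is absurd. *)
Require Import Defs.
From mathcomp Require Import all_boot all_order all_algebra.
Import GRing.Theory Num.Theory.

Lemma odd_sum (I : Type) (s : seq I) (F : I -> nat) :
  odd (\sum_(i <- s) F i) = odd (count (fun i => odd (F i)) s).
Proof.
by elim: s => [|i s IHs]; rewrite ?big_nil // big_cons /= !oddD oddb IHs.
Qed.

Section SequenceInvolution.

Variables (T : eqType) (s : seq T) (f : T -> T).
Hypotheses (s_uniq : uniq s) (f_stable : {in s, forall x, f x \in s}).
Hypothesis fK : {in s, cancel f f}.

Lemma perm_map_involution : perm_eq [seq f x | x <- s] s.
Proof.
have fs_uniq : uniq [seq f x | x <- s].
  by rewrite map_inj_in_uniq //; apply: can_in_inj fK.
have fs_sub : {subset [seq f x | x <- s] <= s}.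
  by move=> _ /mapP[x x_s ->]; apply: f_stable.
apply: uniq_perm => //.
by have [] := uniq_min_size fs_uniq fs_sub; rewrite ?size_map.
Qed.

(* An element that is moved lies either before or after its image in [s], and
   [f] exchanges the two cases. *)
Lemma odd_size_involution : odd (size s) = odd (count (fun x => f x == x) s).
Proof.
pose before x := index x s < index (f x) s.
pose after x := index (f x) s < index x s.
have count_before_after : count before s = count after s.
  have /permP <- := perm_map_involution; rewrite count_map.
  by apply: eq_in_count => x x_s; rewrite /= /before fK.
have count_moved : count (predC (fun x => f x == x)) s
                   = count before s + count after s.
  have disjoint_before_after : count (predI before after) s = 0.
    rewrite -(count_pred0 s); apply: eq_count => x.
    by rewrite /= /before /after; case: ltngtP.
  rewrite -count_predUI disjoint_before_after addn0.
  apply: eq_in_count => x x_s; rewrite /= -neq_ltn eq_sym; congr (~~ _).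
  by apply/eqP/eqP => [<- //|]; apply: (index_inj x) => //; apply: f_stable.
rewrite -(count_predC (fun x => f x == x)) count_moved count_before_after.
by rewrite addnn oddD odd_double addbF.
Qed.

End SequenceInvolution.

Lemma divKn {n d} : 0 < n -> d %| n -> n %/ (n %/ d) = d.
Proof. by move=> n_gt0 d_n; rewrite divnA // mulKn. Qed.

Lemma odd_size_divisorsP n :
  0 < n -> reflect (perfect_square n) (odd (size (divisors n))).
Proof.
move=> n_gt0.
rewrite (odd_size_involution _ _ (divn n)) ?divisors_uniq //; first last.
- by move=> d; rewrite -dvdn_divisors //; apply: divKn.
- by move=> d; rewrite -!dvdn_divisors //; apply: dvdn_div.
have fixedE d : d \in divisors n -> (n %/ d == d) = (n == d ^ 2).
  rewrite -dvdn_divisors // => d_n.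
  by rewrite eq_sym eqn_div ?(dvdn_gt0 n_gt0) // mulnn eq_sym.
rewrite (eq_in_count fixedE); apply: (iffP idP) => [|[m n_sqr]].
  by move/odd_gt0; rewrite -has_count => /hasP[d _ /eqP]; exists d.
rewrite (@eq_count _ _ (pred1 m)) => [|d]; last first.
  by rewrite /= n_sqr eqn_exp2r // eq_sym.
rewrite count_uniq_mem ?divisors_uniq // -dvdn_divisors // n_sqr.
by rewrite -mulnn dvdn_mulr.
Qed.

Lemma perm_divisors_partn (pi : nat_pred) {n} :
  0 < n -> perm_eq [seq d <- divisors n | pi.-nat d] (divisors n`_pi).
Proof.
move=> n_gt0; apply: uniq_perm; rewrite ?filter_uniq ?divisors_uniq // => d.
rewrite mem_filter -!dvdn_divisors ?part_gt0 //.
apply/andP/idP => [[d_pi d_n]|d_n].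
  by rewrite -(part_pnat_id d_pi) partn_dvd.
by rewrite (pnat_dvd d_n) ?part_pnat // (dvdn_trans d_n) ?dvdn_part.
Qed.

Lemma odd_sigma0 n : odd (sigma 0 n) = odd (size (divisors n)).
Proof. by rewrite /sigma odd_sum -count_predT. Qed.

Lemma odd_sigmaS a n :
  0 < n -> odd (sigma a.+1 n) = odd (size (divisors n`_2^')).
Proof.
move=> n_gt0; rewrite /sigma odd_sum -(perm_size (perm_divisors_partn _ n_gt0)).
by rewrite size_filter; congr odd; apply: eq_count => d; rewrite oddX odd_2'nat.
Qed.

Lemma odd_sigma_square a {n} : 0 < n -> perfect_square n -> odd (sigma a n).
Proof.
move=> n_gt0 n_sqr; case: a => [|a].
  by rewrite odd_sigma0; apply/odd_size_divisorsP.
rewrite odd_sigmaS //; apply/odd_size_divisorsP; first exact: part_gt0.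
by case: n_sqr => m ->; exists m`_2^'; apply: partnX.
Qed.

Lemma expn_neq_prime_mul p k m e :
  prime p -> ~~ (p %| k) -> 1 < e -> m ^ e != p * k.
Proof.
move=> p_prime p_ndvd_k e_gt1; apply: contraNneq p_ndvd_k => m_pk.
have /andP[p_dvd_m _] : (p %| m) && (0 < e).
  by rewrite -Euclid_dvdX // m_pk dvdn_mulr.
rewrite -(dvdn_pmul2l (prime_gt0 p_prime)) -m_pk mulnn.
by apply: dvdn_trans (dvdn_exp2l m e_gt1); rewrite dvdn_exp2r.
Qed.

Lemma strong_alpha_omega_le2 {a b n} : strong_alpha a b n -> omega n <= 2 ->
  sigma a n = 2 * n ^ b \/ n ^ b = 2 * sigma a n.
Proof.
case=> _ [x [y [x_gt0 y_gt0 co_xy sigma_rat /andP[max_ge2 max_le]]]] n_le2.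
have sigma_nat : y * sigma a n = x * n ^ b.
  apply/eqP; rewrite -(eqr_nat rat) !natrM natrX sigma_rat mulrA.
  by rewrite [(_ * (_ / _))%R]mulrC divfK // pnatr_eq0 -lt0n.
have := leq_trans max_le n_le2; rewrite geq_max => /andP[x_le2 y_le2].
case: x x_gt0 x_le2 co_xy sigma_nat max_ge2 {sigma_rat max_le}
  => [|[|[|]]] // _ _; case: y y_gt0 y_le2 => [|[|[|]]] // _ _ _;
  rewrite mul1n => sigma_nat _.
- by right.
- by left.
Qed.

Theorem theorem3p9 (a b n : nat) (hn : strong_alpha a b n)
  (hw : omega n <= 2) : ~ perfect_square n.
Proof.
move=> n_sqr; have n_gt0 : 0 < n by case: hn.
have sigma_odd := odd_sigma_square a n_gt0 n_sqr.
case: (strong_alpha_omega_le2 hn hw) => [sigma_double|n_double].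
  by move: sigma_odd; rewrite sigma_double oddM.
have [m n_m2] := n_sqr; move/eqP: n_double; apply/negP.
by rewrite n_m2 expnAC expn_neq_prime_mul // dvdn2 -n_m2 negbK.
Qed.
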